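(* Let $m\ge 1$ and $r\ge 2$ be integers. For an edge-path connected simplicial complex $K$, $$\mathrm{scat}_m(K^{r-1})\le\mathrm{TC}_r^m(K)\le\mathrm{scat}_m(K^r).$$
   Context: Simplicial complexes are abstract simplicial complexes. A complex is edge-path connected if any two vertices are joined by a finite chain of edges. Subcomplexes used in coverings and the test complexes $P$ below need not be connected. Two simplicial maps $\varphi,\psi:A\to B$ are contiguous, $\varphi\sim_c\psi$, if for every simplex $\{v_0,\dots,v_k\}$ of $A$ the set $\{\varphi(v_0),\dots,\varphi(v_k),\psi(v_0),\dots,\psi(v_k)\}$ is a simplex of $B$. They are in the same contiguity class, $\varphi\sim\psi$, if there is a finite sequence of simplicial maps $A\to B$ starting at $\varphi$ and ending at $\psi$ in which consecutive maps are contiguous. For $m\ge 1$, the $m$-simplicial LS category $\mathrm{scat}_m(A)$ is the least integer $k\ge 0$ such that $A$ has a cover by subcomplexes $A_0,\dots,A_k$ with the property that, for each $j$ and every simplicial map $\eta:P\to A_j$ from an $m$-dimensional simplicial complex $P$, one has $\iota_j\circ\eta\sim c_{a_0}\circ\eta$, where $\iota_j:A_j\to A$ is the inclusion and $c_{a_0}:A_j\to A$ is the constant map at a fixed vertex $a_0$ of $A$ (the choice of vertex is immaterial when $A$ is edge-path connected); it is $\infty$ if there is no such cover. $K^r$ denotes the $r$-fold categorical product: its vertices are $r$-tuples of vertices of $K$, and a finite nonempty set of such tuples is a simplex iff for each coordinate the set of its coordinate entries is a simplex of $K$. The sequential $m$-discrete topological complexity $\mathrm{TC}_r^m(K)$ is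 the least integer $k\ge 0$ such that $K^r$ can be covered by subcomplexes $\Omega_0,\dots,\Omega_k$, for each of which there exists a simplicial map $\sigma_j:\Omega_j\to K$ such that for every simplicial map $\eta:P\to\Omega_j$ from an $m$-dimensional simplicial complex $P$ one has $\Delta\circ\sigma_j\circ\eta\sim\iota_j\circ\eta$, where $\iota_j:\Omega_j\hookrightarrow K^r$ is the inclusion and $\Delta:K\to K^r$ is the diagonal map; it is $\infty$ if there is no such covering. *)

(* Defs.v *)
From Stdlib Require Import Relation_Operators.
From mathcomp Require Import all_boot all_order all_algebra.
From mathcomp Require Import boolp classical_sets functions cardinality.
From mathcomp Require Import constructive_ereal.

Set Implicit Arguments.
Unset Strict Implicit.
Unset Printing Implicit Defensive.

Local Open Scope classical_set_scope.
Local Open Scope card_scope.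

(* Complexes may be infinite, and may be empty. *)
Record simplicial_complex := SimplicialComplex {
  vertex :> Type;
  simplex : set (set vertex);
  simplex_finite : forall s, simplex s -> finite_set s;
  simplex_nonempty : forall s, simplex s -> s !=set0;
  simplex_face : forall s t, simplex s -> t `<=` s -> t !=set0 -> simplex t;
  simplex_vertex : forall v, simplex [set v] }.

Definition edge (K : simplicial_complex) (v w : K) : Prop :=
  v <> w /\ simplex [set v; w].

(* [clos_refl_trans] is Stdlib's reflexive-transitive closure, i.e. the
   existence of a finite chain. *)
Definition edge_path_connected (K : simplicial_complex) : Prop :=
  forall v w : K, clos_refl_trans K (@edge K) v w.

Definition has_dim (m : nat) (K : simplicial_complex) : Prop :=
  (forall s : set K, simplex s -> s #<= `I_m.+1) /\
  (exists s : set K, simplex s /\ s #= `I_m.+1).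

Record simplicial_map (A B : simplicial_complex) := SimplicialMap {
  vertex_map :> A -> B;
  simplicial_mapP : forall s, simplex s -> simplex (vertex_map @` s) }.

Lemma smap_comp_subproof (A B C : simplicial_complex)
    (g : simplicial_map B C) (f : simplicial_map A B) (s : set A) :
  simplex s -> simplex ((g \o f) @` s).
Proof. by move=> ss; rewrite -image_comp; do 2 apply: simplicial_mapP. Qed.

Definition smap_comp (A B C : simplicial_complex)
    (g : simplicial_map B C) (f : simplicial_map A B) : simplicial_map A C :=
  SimplicialMap (smap_comp_subproof g f).

Lemma smap_const_subproof (A B : simplicial_complex) (b : B) (s : set A) :
  simplex s -> simplex ((fun=> b) @` s).
Proof.
move=> ss; apply: (simplex_face (simplex_vertex b)) => [_ [x _ <-] //|].
by have [x sx] := simplex_nonempty ss; exists b, x.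
Qed.

Definition smap_const (A B : simplicial_complex) (b : B) :
  simplicial_map A B := SimplicialMap (@smap_const_subproof A B b).

Definition contiguous (A B : simplicial_complex) (f g : simplicial_map A B) :
  Prop := forall s : set A, simplex s -> simplex (f @` s `|` g @` s).

Definition same_contiguity_class (A B : simplicial_complex)
  (f g : simplicial_map A B) : Prop :=
  clos_refl_trans (simplicial_map A B) (@contiguous A B) f g.

Definition same_contiguity_class_dim (m : nat) (A B : simplicial_complex)
  (f g : simplicial_map A B) : Prop :=
  forall P : simplicial_complex, has_dim m P ->
  forall eta : simplicial_map P A,
    same_contiguity_class (smap_comp f eta) (smap_comp g eta).

(* A subcomplex is given by its simplices; it need not contain all the vertices
   of [A], and may be empty. *)
Record subcomplex (A : simplicial_complex) := Subcomplex {
  sub_simplex : set (set A);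
  sub_simplexW : forall s, sub_simplex s -> simplex s;
  sub_simplex_face :
    forall s t, sub_simplex s -> t `<=` s -> t !=set0 -> sub_simplex t }.

Definition subcomplex_simplex (A : simplicial_complex) (U : subcomplex A) :
  set (set {v : A | sub_simplex U [set v]}) := [set s | sub_simplex U (sval @` s)].

Lemma subcomplex_simplex_finite (A : simplicial_complex) (U : subcomplex A) s :
  @subcomplex_simplex A U s -> finite_set s.
Proof.
move=> /sub_simplexW/simplex_finite; rewrite (eq_finite_set (B := s)) //.
by apply: inj_card_eq => x y _ _; apply: eq_sig_hprop => v; exact: Prop_irrelevance.
Qed.

Lemma subcomplex_simplex_nonempty (A : simplicial_complex) (U : subcomplex A) s :
  @subcomplex_simplex A U s -> s !=set0.
Proof. by move=> /sub_simplexW/simplex_nonempty [_ [x sx _]]; exists x. Qed.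

Lemma subcomplex_simplex_face (A : simplicial_complex) (U : subcomplex A) s t :
  @subcomplex_simplex A U s -> t `<=` s -> t !=set0 -> @subcomplex_simplex A U t.
Proof.
move=> Us ts [x tx]; apply: (sub_simplex_face Us); first exact: image_subset.
by exists (sval x), x.
Qed.

Lemma subcomplex_simplex_vertex (A : simplicial_complex) (U : subcomplex A) v :
  @subcomplex_simplex A U [set v].
Proof. by rewrite /subcomplex_simplex /= image_set1; exact: (svalP v). Qed.

Definition complex_of_subcomplex (A : simplicial_complex) (U : subcomplex A) :
  simplicial_complex :=
  SimplicialComplex (@subcomplex_simplex_finite A U)
    (@subcomplex_simplex_nonempty A U) (@subcomplex_simplex_face A U)
    (@subcomplex_simplex_vertex A U).

Coercion complex_of_subcomplex : subcomplex >-> simplicial_complex.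

Lemma smap_incl_subproof (A : simplicial_complex) (U : subcomplex A)
    (s : set (complex_of_subcomplex U)) :
  simplex s -> simplex ((fun v : complex_of_subcomplex U => sval v) @` s).
Proof. exact: sub_simplexW. Qed.

Definition smap_incl (A : simplicial_complex) (U : subcomplex A) :
  simplicial_map U A := SimplicialMap (@smap_incl_subproof A U).

Definition covers (A : simplicial_complex) (n : nat)
  (U : 'I_n -> subcomplex A) : Prop :=
  forall s : set A, simplex s -> exists j, sub_simplex (U j) s.

(* The least element of [P], and [+oo] if [P] is empty; the values live in the
   integers extended by [+oo] and [-oo]. *)
Definition least_or_infty (P : set nat) : \bar int :=
  if pselect (exists k, `[< P k >]) is left exP
  then EFin (Posz (ex_minn exP)) else EPInf int.

(* The m-simplicial LS category of [A], computed with the vertex [a] of [A]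
   as target of the constant maps. *)
Definition scat (m : nat) (A : simplicial_complex) (a : A) : \bar int :=
  least_or_infty [set k | exists U : 'I_k.+1 -> subcomplex A,
    covers U /\
    forall j, same_contiguity_class_dim m (smap_incl (U j)) (smap_const (U j) a)].

Arguments scat m A a : clear implicits.

Definition power_simplex (K : simplicial_complex) (r : nat) :
  set (set ('I_r -> K)) :=
  [set s | [/\ finite_set s, s !=set0 &
     forall i, simplex ((fun x : 'I_r -> K => x i) @` s)]].

Lemma power_simplex_finite (K : simplicial_complex) (r : nat) s :
  @power_simplex K r s -> finite_set s.
Proof. by case. Qed.

Lemma power_simplex_nonempty (K : simplicial_complex) (r : nat) s :
  @power_simplex K r s -> s !=set0.
Proof. by case. Qed.

Lemma power_simplex_face (K : simplicial_complex) (r : nat) s t :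
  @power_simplex K r s -> t `<=` s -> t !=set0 -> @power_simplex K r t.
Proof.
move=> [sfin _ sK] ts [x tx]; split; [exact: sub_finite_set sfin|by exists x|].
move=> i; apply: (simplex_face (sK i)); first exact: image_subset.
by exists (x i), x.
Qed.

Lemma power_simplex_vertex (K : simplicial_complex) (r : nat) v :
  @power_simplex K r [set v].
Proof.
split; [exact: finite_set1|by exists v|move=> i].
by rewrite image_set1; exact: simplex_vertex.
Qed.

Definition power (K : simplicial_complex) (r : nat) : simplicial_complex :=
  SimplicialComplex (@power_simplex_finite K r) (@power_simplex_nonempty K r)
    (@power_simplex_face K r) (@power_simplex_vertex K r).

Lemma diagonal_subproof (K : simplicial_complex) (r : nat) (s : set K) :
  simplex s -> @simplex (power K r) ((fun v : K => (fun=> v) : power K r) @` s).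
Proof.
move=> ss; split; first exact: finite_image (simplex_finite ss).
  by have [x sx] := simplex_nonempty ss; exists (fun=> x), x.
by move=> i; rewrite image_comp /comp /= image_id.
Qed.

Definition diagonal (K : simplicial_complex) (r : nat) :
  simplicial_map K (power K r) := SimplicialMap (@diagonal_subproof K r).

Definition TC (m r : nat) (K : simplicial_complex) : \bar int :=
  least_or_infty [set k | exists U : 'I_k.+1 -> subcomplex (power K r),
    covers U /\
    forall j, exists sigma : simplicial_map (U j) K,
      same_contiguity_class_dim m
        (smap_comp (diagonal K r) sigma) (smap_incl (U j))].

(* Main.v *)
(** For the upper bound, on a subcomplex whose inclusion becomes trivial on
    [m]-dimensional complexes a constant map serves as [sigma]: constant maps
    into the connected complex [K^r] lie in one contiguity class.

    For the lower bound, a subcomplex [Omega] of [K^r] with partial section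
    [sigma] is pulled back along [i : x |-> (v, x)].  On the pullback, the first
    coordinate of [Delta sigma i eta ~ i eta] shows that [sigma i eta] is
    homotopic to the constant [v], and the remaining coordinates then show that
    [eta] is homotopic to [Delta sigma i eta], hence to a constant. *)
Require Import Defs.
From Stdlib Require Import Relation_Operators.
From mathcomp Require Import all_boot all_order all_algebra.
From mathcomp Require Import boolp classical_sets functions cardinality.
From mathcomp Require Import constructive_ereal.

Set Implicit Arguments.
Unset Strict Implicit.
Unset Printing Implicit Defensive.

Local Open Scope classical_set_scope.

(** Through this, each inequality reduces to turning a cover counted on the larger side into one
    with as many pieces for the smaller side. *)
Lemma least_or_infty_le (P Q : set nat) :
  Q `<=` P -> (least_or_infty P <= least_or_infty Q)%E.
Proof.
rewrite /least_or_infty => QP.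
case: (pselect (exists k, `[< Q k >])) => [exQ|_]; last exact: leey.
case: pselect => [exP|[]]; last first.
  by case: exQ => k /asboolP/QP Pk; exists k; apply/asboolP.
rewrite lee_fin; case: ex_minnP => p _ pmin; case: ex_minnP => q /asboolP Qq _.
by apply: pmin; apply/asboolP/QP.
Qed.

Lemma smap_id_subproof (A : simplicial_complex) (s : set A) :
  simplex s -> simplex (id @` s).
Proof. by rewrite image_id. Qed.

Definition smap_id (A : simplicial_complex) : simplicial_map A A :=
  SimplicialMap (@smap_id_subproof A).

Lemma smap_proj_subproof (K : simplicial_complex) (n : nat) (i : 'I_n)
    (s : set (power K n)) :
  simplex s -> simplex ((fun x : power K n => x i) @` s).
Proof. by case. Qed.

Definition smap_proj (K : simplicial_complex) (n : nat) (i : 'I_n) :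
  simplicial_map (power K n) K := SimplicialMap (@smap_proj_subproof K n i).

Lemma smap_tuple_subproof (A K : simplicial_complex) (n : nat)
    (f : 'I_n -> simplicial_map A K) (s : set A) :
  simplex s ->
  @simplex (power K n) ((fun v => (fun i => f i v) : power K n) @` s).
Proof.
move=> ss; split; first exact: finite_image (simplex_finite ss).
  by have [x sx] := simplex_nonempty ss; exists (fun i => f i x), x.
by move=> i; rewrite image_comp; apply: (simplicial_mapP (f i)).
Qed.

Definition smap_tuple (A K : simplicial_complex) (n : nat)
    (f : 'I_n -> simplicial_map A K) : simplicial_map A (power K n) :=
  SimplicialMap (smap_tuple_subproof f).

Section Pullback.
Variables (A B : simplicial_complex) (f : simplicial_map A B).
Variable U : subcomplex B.

(** The condition [simplex s] is imposed separately, since [f] may send a set that is not a simplex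
    of [A] onto a simplex of [U]. *)
Definition pullback_simplex : set (set A) :=
  [set s | simplex s /\ sub_simplex U (f @` s)].

Lemma pullback_simplexW (s : set A) : pullback_simplex s -> simplex s.
Proof. by case. Qed.

Lemma pullback_simplex_face (s t : set A) :
  pullback_simplex s -> t `<=` s -> t !=set0 -> pullback_simplex t.
Proof.
move=> [ss Us] ts t0; split; first exact: simplex_face ts t0.
apply: (sub_simplex_face Us); first exact: image_subset.
by case: t0 => x tx; exists (f x), x.
Qed.

Definition pullback : subcomplex A :=
  Subcomplex pullback_simplexW pullback_simplex_face.

Lemma pullback_vertex (v : pullback) : sub_simplex U [set f (sval v)].
Proof. by case: v => v /= [_]; rewrite image_set1. Qed.

Definition pullback_fun (v : pullback) : U :=
  exist _ (f (sval v)) (pullback_vertex v).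

Lemma pullback_map_subproof (s : set pullback) :
  simplex s -> simplex (pullback_fun @` s).
Proof.
case=> _; rewrite /simplex /= /subcomplex_simplex /=.
by rewrite !image_comp.
Qed.

Definition pullback_map : simplicial_map pullback U :=
  SimplicialMap pullback_map_subproof.

End Pullback.

Lemma covers_pullback (A B : simplicial_complex) (f : simplicial_map A B)
    (n : nat) (U : 'I_n -> subcomplex B) :
  covers U -> covers (fun j => pullback f (U j)).
Proof.
move=> Ucov s ss; have [j Uj] := Ucov _ (simplicial_mapP f ss).
by exists j; split.
Qed.

Lemma contiguous_sym (A B : simplicial_complex) (f g : simplicial_map A B) :
  contiguous f g -> contiguous g f.
Proof. by move=> fg s /fg; rewrite setUC. Qed.

Lemma same_contiguity_class_sym (A B : simplicial_complex)
    (f g : simplicial_map A B) :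
  same_contiguity_class f g -> same_contiguity_class g f.
Proof.
elim=> [f' g' /contiguous_sym|f'|f' g' h' _ gf _ hg]; first exact: rt_step.
  exact: rt_refl.
exact: rt_trans hg gf.
Qed.

(** Contiguity sees only vertex maps, so a single step joins maps that agree pointwise, whatever
    their proof components. *)
Lemma same_contiguity_class_eqfun (A B : simplicial_complex)
    (f g : simplicial_map A B) : f =1 g -> same_contiguity_class f g.
Proof.
move=> fg; apply: rt_step => s ss.
by rewrite -(eq_imagel (fun x _ => fg x)) setUid; apply: simplicial_mapP.
Qed.

Lemma eq_same_contiguity_class (A B : simplicial_complex)
    (f g f' g' : simplicial_map A B) : f =1 f' -> g =1 g' ->
  same_contiguity_class f g -> same_contiguity_class f' g'.
Proof.
move=> ff' gg' fg; apply: rt_trans (same_contiguity_class_eqfun gg').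
by apply: rt_trans fg; apply: same_contiguity_class_eqfun => x; rewrite ff'.
Qed.

Lemma same_contiguity_class_compl (A B C : simplicial_complex)
    (h : simplicial_map B C) (f g : simplicial_map A B) :
  same_contiguity_class f g ->
  same_contiguity_class (smap_comp h f) (smap_comp h g).
Proof.
elim=> [f' g' fg|f'|f' g' h' _ fg _ gh]; last exact: rt_trans fg gh.
  apply: rt_step => s /fg; move/(simplicial_mapP h).
  by rewrite image_setU !image_comp.
exact: rt_refl.
Qed.

Lemma const_same_contiguity_class (A B : simplicial_complex) (u v : B) :
  clos_refl_trans B (@edge B) u v ->
  same_contiguity_class (smap_const A u) (smap_const A v).
Proof.
elim=> [x y [_ xy]|x|x y z _ xy _ yz]; last exact: rt_trans xy yz.
  apply: rt_step => s /simplex_nonempty s0.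
  (* As [s] is nonempty, the two constant images are singletons whose union is the edge itself. *)
  by rewrite /= !(set_cst, ifN) //; apply/set0P.
exact: rt_refl.
Qed.

(* Two tuples are joined by changing one coordinate at a time. *)
Lemma const_power_same_contiguity_class (A K : simplicial_complex) (n : nat)
    (u v : power K n) : edge_path_connected K ->
  same_contiguity_class (smap_const A u) (smap_const A v).
Proof.
move=> Kconn.
(* Interpolates from [u] to [v]; passing from [w k] to [w k.+1] affects coordinate [k] only. *)
pose w k : power K n := fun i => if (i < k)%N then v i else u i.
have w0 : w 0%N = u by apply/funext => i.
have wn : w n = v by apply/funext => i; rewrite /w ltn_ord.
suff: forall k, (k <= n)%N ->
    same_contiguity_class (smap_const A u) (smap_const A (w k)).
  by move=> /(_ n (leqnn n)); rewrite wn.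
elim=> [_|k IHk kn]; first by rewrite w0; exact: rt_refl.
apply: rt_trans (IHk (ltnW kn)) _.
pose i := Ordinal kn.
(* The line through [w k] in direction [i]: it carries an edge path from [u i] to [v i] to a chain
   of constants from [w k] to [w k.+1]. *)
pose axis := smap_tuple
  (fun j => if j == i then smap_id K else smap_const K (w k j)).
have axisE z j : axis z j = if j == i then z else w k j by rewrite /=; case: ifP.
have axis_u : axis (u i) = w k.
  apply/funext => j; rewrite axisE; case: eqP => // ->.
  by rewrite /w /= ltnn.
have axis_v : axis (v i) = w k.+1.
  apply/funext => j; rewrite axisE; case: eqP => [->|/eqP ji].
    by rewrite /w /= ltnSn.
  by rewrite /w ltnS [(j <= k)%N]leq_eqVlt (negPf (ji : (j : nat) != k)).
rewrite -axis_u -axis_v.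
have := const_same_contiguity_class A (Kconn (u i) (v i)).
by move=> /(same_contiguity_class_compl axis); exact: eq_same_contiguity_class.
Qed.

Lemma TC_le_scat (m n : nat) (K : simplicial_complex) (b : power K n.+1) :
  edge_path_connected K -> (TC m n.+1 K <= scat m (power K n.+1) b)%E.
Proof.
move=> Kconn; apply: least_or_infty_le => k [U [Ucov Ub]].
(* The choice of [ord0] is arbitrary: the diagonal of this constant is again constant, and
   connectedness moves it to [b]. *)
exists U; split=> // j; exists (smap_const (U j) (b ord0)) => P Pm eta.
apply: rt_trans (same_contiguity_class_sym (Ub j P Pm eta)).
apply: eq_same_contiguity_class
  (const_power_same_contiguity_class P (fun=> b ord0) b Kconn); by [].
Qed.

Lemma scat_le_TC (m n : nat) (K : simplicial_complex) (a : power K n.+1) :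
  edge_path_connected K -> (scat m (power K n.+1) a <= TC m n.+2 K)%E.
Proof.
move=> Kconn; apply: least_or_infty_le => k [U [Ucov Usec]].
pose v := a ord0.
(* [unlift ord0 j] is [None] exactly at [j = ord0], where the entry [v] is inserted. *)
pose i : simplicial_map (power K n.+1) (power K n.+2) := smap_tuple (fun j =>
  if unlift ord0 j is Some l then smap_proj K l else smap_const _ v).
(* A left inverse of [i] that sends diagonal tuples to diagonal tuples. *)
pose tail : simplicial_map (power K n.+2) (power K n.+1) :=
  smap_tuple (fun j => smap_proj K (lift ord0 j)).
exists (fun j => pullback i (U j)); split; first exact: covers_pullback.
move=> j P Pm eta; have [sigma sigmaP] := Usec j.
(* This is [i eta] with values in [U j], where [sigma] is defined. *)
pose theta := smap_comp (pullback_map i (U j)) eta.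
have Dth := sigmaP P Pm theta.
have to_v : same_contiguity_class (smap_comp sigma theta) (smap_const P v).
  have := same_contiguity_class_compl (smap_proj K ord0) Dth.
  by apply: eq_same_contiguity_class => x //=; rewrite unlift_none.
have to_diag : same_contiguity_class
    (smap_comp (smap_incl (pullback i (U j))) eta)
    (smap_comp (Defs.diagonal K n.+1) (smap_comp sigma theta)).
  have := same_contiguity_class_sym (same_contiguity_class_compl tail Dth).
  apply: eq_same_contiguity_class => x //=.
  by apply/funext => l; rewrite /= liftK.
apply: rt_trans to_diag _.
apply: rt_trans (same_contiguity_class_compl (Defs.diagonal K n.+1) to_v) _.
(* The constant reached is the diagonal tuple of [v], which may differ from [a]. *)
apply: eq_same_contiguity_class
  (const_power_same_contiguity_class P (fun=> v) a Kconn); by [].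
Qed.

Theorem theorem6p4 (m r : nat) (K : simplicial_complex)
    (a : power K r.-1) (b : power K r) :
  (1 <= m)%N -> (2 <= r)%N -> edge_path_connected K ->
  (scat m (power K r.-1) a <= TC m r K)%E /\ (TC m r K <= scat m (power K r) b)%E.
Proof.
(* With [r = n.+2], both exponents are successors, so coordinate [ord0] exists in both powers. *)
case: r a b => [//|[//|n]] a b _ _ Kconn.
by split; [exact: scat_le_TC|exact: TC_le_scat].
Qed.
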